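(* Let $K$ be a finite simplicial complex which is strong collapsible and vertex-homogeneous. Then $K$ is a simplex.
   Context: All simplicial complexes are finite (simplices are nonempty finite sets of vertices). A complex $K$ is vertex-homogeneous if for any two vertices $v,w\in K$ there is a simplicial automorphism $\varphi:K\to K$ with $\varphi(v)=w$. For a vertex $v$ of a complex $K$, the link $\mathrm{lk}_K(v)$ is the subcomplex of simplices $\tau\in K$ with $v\notin\tau$ and $\tau\cup\{v\}\in K$, and $K\smallsetminus v$ is the full subcomplex of $K$ spanned by the vertices different from $v$. A simplicial cone is a complex $aM$, the join of a (possibly empty) complex $M$ and a vertex $a$ not in $M$; its simplices are $\{a\}$, the simplices $\tau$ of $M$, and the sets $\{a\}\cup\tau$ with $\tau\in M$. A vertex $v$ of $K$ is dominated if $\mathrm{lk}_K(v)$ is a simplicial cone; in that case there is an elementary strong collapse from $K$ to $K\smallsetminus v$. A complex is strong collapsible if there is a finite (possibly empty) sequence of elementary strong collapses from it to one of its vertices. ''$K$ is a simplex'' means that the set of all vertices of $K$ is a simplex of $K$. *)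

(* Defs.v *)
From mathcomp Require Import all_boot.
Set Implicit Arguments.
Unset Strict Implicit.
Unset Printing Implicit Defensive.

(* Finite simplicial complexes with vertices in a finite type T, as sets of
   nonempty finite sets closed under nonempty subsets.  Elements of T need not
   be vertices, so subcomplexes live over the same T; the complex set0 is
   allowed. *)
Section Complexes.
Variable T : finType.
Implicit Types (K L M : {set {set T}}) (s t W : {set T}) (v w a : T).

Definition is_complex K : bool :=
  (set0 \notin K) &&
  [forall s in K, forall t : {set T}, (t != set0) && (t \subset s) ==> (t \in K)].

Definition vertices K : {set T} := [set v | [set v] \in K].

Definition link K v : {set {set T}} :=
  [set t in K | (v \notin t) && (v |: t \in K)].

Definition full_subcomplex K W : {set {set T}} := [set s in K | s \subset W].

Definition delete_vertex K v : {set {set T}} :=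
  full_subcomplex K (vertices K :\ v).

Definition cone a M : {set {set T}} :=
  [set a] |: (M :|: [set a |: t | t in M]).

Definition is_cone L : bool :=
  [exists a, exists M : {set {set T}},
    [&& is_complex M, a \notin vertices M & L == cone a M]].

Definition dominated K v : bool := (v \in vertices K) && is_cone (link K v).

Definition elementary_strong_collapse : rel {set {set T}} :=
  fun K L => [exists v, dominated K v && (L == delete_vertex K v)].

(* [connect] is the reflexive transitive closure. *)
Definition strong_collapsible K : bool :=
  [exists v in vertices K, connect elementary_strong_collapse K [set [set v]]].

Definition is_simplex K : bool := vertices K \in K.

(* A simplicial map is given by any function on T; only its values on the
   vertices of the source matter. *)
Definition simplicial_map K L (f : T -> T) : Prop :=
  {in K, forall s, f @: s \in L}.

Definition simplicial_automorphism K (f : T -> T) : Prop :=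
  simplicial_map K K f /\
  exists g : T -> T, [/\ simplicial_map K K g,
    {in vertices K, cancel f g} & {in vertices K, cancel g f}].

Definition vertex_homogeneous K : Prop :=
  {in vertices K &, forall v w,
    exists2 f : T -> T, simplicial_automorphism K f & f v = w}.

End Complexes.

(* Main.v *)
(** Call two vertices equivalent when they have the same closed star; a simplex
    may be enlarged by any vertices equivalent to some of its own.  Closed stars
    of a vertex-homogeneous complex all have the same number of simplices, so if
    [v] is dominated by [a] (that is, if the star of [v] lies in that of [a])
    then [v] and [a] are equivalent.  Along a sequence of strong collapses
    the remaining vertex set therefore always meets every equivalence class: a
    domination in a full subcomplex on such a set is already one in [K], and the
    dominating vertex still represents the class of the deleted one.  Ending at a
    single vertex means that there is only one class. *)

Require Import Defs.
From mathcomp Require Import all_boot.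
Set Implicit Arguments.
Unset Strict Implicit.
Unset Printing Implicit Defensive.

Section ClosedStars.
Variables (T : finType) (K : {set {set T}}).
Hypothesis K_complex : is_complex K.

Implicit Types (s t A W : {set T}) (v w a : T).

Lemma complex_face s t : s \in K -> t != set0 -> t \subset s -> t \in K.
Proof.
move=> sK t0 ts; have /andP[_ /'forall_implyP/(_ s sK)/forallP/(_ t)] := K_complex.
by rewrite t0 ts.
Qed.

Lemma complex_face1 s t x : s \in K -> x \in t -> t \subset s -> t \in K.
Proof. by move=> sK xt; apply: complex_face => //; apply/set0Pn; exists x. Qed.

Lemma simplex_vertices s x : s \in K -> x \in s -> x \in vertices K.
Proof.
by move=> sK xs; rewrite inE (@complex_face1 s _ x) ?set11 ?sub1set.
Qed.

Definition closed_star v := [set s in K | v |: s \in K].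

Lemma simplex_closed_star s x : s \in K -> x \in s -> s \in closed_star x.
Proof. by move=> sK xs; rewrite inE sK (setUidPr _) ?sub1set. Qed.

(** The vertices of [A] are added one at a time: a simplex that contains [u] lies in the closed star
    of [u], hence in that of any [x] equivalent to [u], so [x] can be joined to it. *)
Lemma simplex_saturate s A : s \in K ->
  (forall x, x \in A -> exists2 u, u \in s & closed_star x = closed_star u) ->
  A :|: s \in K.
Proof.
move=> sK.
rewrite -[A]set_enum; elim: (enum A) => [|x l IH] Al.
  by rewrite set_nil set0U.
have lsK : [set:: l] :|: s \in K.
  by apply: IH => y; rewrite inE => yl; apply: Al; rewrite !inE yl orbT.
have [|u us eq_xu] := Al x; first by rewrite !inE eqxx.
have : [set:: l] :|: s \in closed_star u.
  by apply: simplex_closed_star; rewrite // inE us orbT.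
by rewrite -eq_xu set_cons -setUA inE => /andP[].
Qed.

(** Taking images under [f] maps one star into the other, injectively because [g] undoes [f] on
    simplices. *)
Lemma card_closed_star_automorphism f v :
  simplicial_automorphism K f -> #|closed_star v| <= #|closed_star (f v)|.
Proof.
move=> [fK [g [_ fg _]]].
have gf s : s \in K -> g @: (f @: s) = s.
  move=> sK; rewrite -imset_comp -[RHS]imset_id; apply: eq_in_imset => x xs.
  by apply: fg; apply: simplex_vertices xs.
rewrite -(@card_in_imset _ _ (fun s => f @: s)).
  apply/subset_leq_card/subsetP => _ /imsetP[s + ->].
  by rewrite !inE => /andP[sK vsK]; rewrite fK //= -imsetU1 fK.
move=> s t; rewrite !inE => /andP[sK _] /andP[tK _] eq_fst.
by rewrite -(gf s sK) eq_fst gf.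
Qed.

Lemma homogeneous_closed_star_eq v w : vertex_homogeneous K ->
  v \in vertices K -> w \in vertices K ->
  closed_star v \subset closed_star w -> closed_star v = closed_star w.
Proof.
move=> Khom vK wK vw; apply/eqP; rewrite eqEcard vw /=.
have [f f_aut <-] := Khom w v wK vK.
exact: card_closed_star_automorphism.
Qed.

Definition meets_star_classes W :=
  W \subset vertices K /\
  {in vertices K, forall v, exists2 w, w \in W & closed_star v = closed_star w}.

Lemma vertices_full_subcomplex W :
  W \subset vertices K -> vertices (full_subcomplex K W) = W.
Proof.
move=> /subsetP WK; apply/setP => x; rewrite !inE sub1set andbC.
by apply/andb_idr => /WK; rewrite inE.
Qed.

Lemma full_subcomplexI W W' : W' \subset W ->
  full_subcomplex (full_subcomplex K W) W' = full_subcomplex K W'.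
Proof.
move=> W'W; apply/setP => s; rewrite !inE -andbA; congr (_ && _).
by apply/andb_idl => /subset_trans; apply.
Qed.

Lemma full_subcomplex_complex W : is_complex (full_subcomplex K W).
Proof.
apply/andP; split.
  by rewrite inE negb_and; case/andP: K_complex => ->.
apply/'forall_implyP => s; rewrite inE => /andP[sK sW].
apply/forall_inP => t /andP[t0 ts].
by rewrite inE (complex_face sK) //= (subset_trans ts).
Qed.

Lemma link_cone_apex v a M : link K v = cone a M ->
  a != v /\ {in K, forall s, v \in s -> a |: s \in K}.
Proof.
move=> linkE.
have a_link : [set a] \in link K v by rewrite linkE !inE eqxx.
split=> [|s sK vs]; first by move: a_link; rewrite !inE eq_sym => /and3P[].
have va t : a |: t \in link K v -> a |: (v |: t) \in K.
  by rewrite inE setUCA => /and3P[].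
(* The simplex [[set v]] is treated apart: its remainder [set0] is not in the link. *)
rewrite -(setD1K vs); have [-> | sv0] := eqVneq (s :\ v) set0.
  by apply: va; rewrite setU0.
apply: va.
have : s :\ v \in link K v.
  by rewrite !inE eqxx setD1K // sK (complex_face sK) // subD1set.
rewrite linkE => /setU1P[-> | /setUP[sM | /imsetP[t tM ->]]].
- by rewrite setUid !inE eqxx.
- by rewrite !inE imset_f ?orbT.
- by rewrite setUA setUid !inE imset_f ?orbT.
Qed.

(** All equivalent vertices in [W] are kept, which avoids choosing one per class. *)
Definition representatives W t :=
  [set u in W | [exists x in t, closed_star u == closed_star x]].

(** A simplex [s] in the star of [v] may leave [W], so it is moved there: saturating [v |: s] shows
    that its representatives form a simplex [s'], which contains [v]. Domination adds [a] to [s'],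
    and saturating [a |: s'] by the vertices of [s] gives a simplex with face [a |: s]. *)
Lemma dominated_closed_star W v a : meets_star_classes W -> v \in W ->
  {in full_subcomplex K W, forall s, v \in s -> a |: s \in full_subcomplex K W} ->
  closed_star v \subset closed_star a.
Proof.
move=> [WK Wrep] vW dom; apply/subsetP => s; rewrite !inE => /andP[sK vsK].
rewrite sK /=; pose s' := representatives W (v |: s).
have s'vsK : s' :|: (v |: s) \in K.
  apply: simplex_saturate => // u; rewrite inE => /andP[_ /exists_inP[x xs /eqP]].
  by exists x.
have vs' : v \in s'.
  by rewrite inE vW; apply/exists_inP; exists v; rewrite ?setU11.
have s'L : s' \in full_subcomplex K W.
  rewrite inE (complex_face1 s'vsK vs') ?subsetUl //=.
  by apply/subsetP => u; rewrite inE => /andP[].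
have := dom s' s'L vs'; rewrite inE => /andP[as'K _].
have sas'K : s :|: (a |: s') \in K.
  apply: simplex_saturate => // x xs.
  have [u uW eq_xu] := Wrep x (simplex_vertices sK xs).
  exists u => //; rewrite !inE uW; apply/orP; right.
  by apply/exists_inP; exists x; rewrite ?inE ?xs ?orbT // eq_xu.
apply: (complex_face1 sas'K (setU11 a s)).
by rewrite setUA [s :|: _]setUC subsetUl.
Qed.

End ClosedStars.

Lemma meets_star_classes_collapse (T : finType) (K L : {set {set T}}) W :
  is_complex K -> vertex_homogeneous K ->
  meets_star_classes K W -> elementary_strong_collapse (full_subcomplex K W) L ->
  exists2 W', meets_star_classes K W' & L = full_subcomplex K W'.
Proof.
move=> Kc Khom Wmeets; have [WK Wrep] := Wmeets.
case/existsP=> v /andP[/andP[vL /existsP[a /existsP[M /and3P[_ _ /eqP linkE]]]]].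
move=> /eqP ->.
have [av dom] := link_cone_apex (full_subcomplex_complex Kc W) linkE.
move: vL; rewrite /delete_vertex vertices_full_subcomplex // => vW.
exists (W :\ v); last by rewrite full_subcomplexI ?subD1set.
have aW : a \in W.
  have vL : [set v] \in full_subcomplex K W.
    by have /subsetP/(_ v vW) := WK; rewrite !inE sub1set vW andbT.
  have := dom _ vL (set11 v); rewrite inE => /andP[_ /subsetP]; apply.
  exact: setU11.
have eq_va : closed_star K v = closed_star K a.
  apply: homogeneous_closed_star_eq => //; try exact: (subsetP WK).
  exact: dominated_closed_star dom.
split=> [|x xK]; first exact: subset_trans (subD1set _ _) WK.
have [u uW eq_xu] := Wrep x xK.
(* The class of the deleted [v] is from now on represented by [a]. *)
have [uv | uv] := eqVneq u v; last by exists u; rewrite // !inE uv.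
by exists a; rewrite ?inE ?av // eq_xu uv.
Qed.

Theorem corollary6p4 (T : finType) (K : {set {set T}})
  (K_complex : is_complex K)
  (K_collapsible : strong_collapsible K)
  (K_homogeneous : vertex_homogeneous K) :
  is_simplex K.
Proof.
have [v vK /connectP[p]] := exists_inP K_collapsible.
(* Only the two occurrences of [K] as start of the path are rewritten; the conclusion stays about
   [K] while [W] varies in the induction. *)
have [W0 meets0 {1 2}->] :
    exists2 W, meets_star_classes K W & K = full_subcomplex K W.
  exists (vertices K); first by split=> // x xK; exists x.
  apply/setP => s; rewrite inE; apply/esym/andb_idr => sK.
  by apply/subsetP => x; apply: simplex_vertices.
elim: p W0 meets0 => [|L p IH] W meets /=; last first.
  move=> /andP[/(meets_star_classes_collapse K_complex K_homogeneous meets)].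
  by move=> [W' meets' ->]; apply: IH.
move=> _ LE; have [WK Wrep] := meets.
have WE : W = [set v].
  rewrite -(vertices_full_subcomplex WK) -LE; apply/setP => x.
  by rewrite !inE (inj_eq set1_inj).
(* Every vertex is now equivalent to [v], so [[set v]] can be saturated by all of [vertices K]. *)
rewrite /is_simplex -(setUidPl (_ : [set v] \subset vertices K)) ?sub1set //.
apply: simplex_saturate => //; first by move: vK; rewrite inE.
by move=> x /Wrep; rewrite WE.
Qed.
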